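(* Let $X$ be a $T_0$-space and $\mathcal{B}$ a family of open subsets of $X$. If a collection of families $\{U_q\colon q\in\mathbb{I}\}$, $U\in\mathcal{B}$, is a $\mathcal{B}$-approximation, then the family $\{f_U\colon U\in\mathcal{B}\}$, where $$f_U(x)=\begin{cases}\sup\{q\in\mathbb{I}\colon x\in U_q\},&\text{when }x\in U;\\ 0,&\text{when }x\notin U,\end{cases}$$ is a $\mathcal{B}$-stratification.
   Context: $\mathbb{I}=(0,1)\cap\mathbb{Q}$. Let $X$ be a $T_0$-space and $\mathcal{B}$ a family of open subsets of $X$. A $\mathcal{B}$-stratification is a family of functions $\{f_U\colon U\in\mathcal{B}\}$, $f_U\colon X\to[0,1]$, such that: (1) $U=f_U^{-1}((0,1])$ for every $U\in\mathcal{B}$; (2) if $U,V\in\mathcal{B}$ and $U\subseteq V$, then $f_U(x)\leqslant f_V(x)$ for every $x\in X$; (3) each $f_U$ is continuous. A $\mathcal{B}$-approximation is an assignment to each $U\in\mathcal{B}$ of a family $\{U_q\colon q\in\mathbb{I}\}$ of open subsets of $X$ such that: (a) $U=\bigcup\{U_q\colon q\in\mathbb{I}\}$ for every $U\in\mathcal{B}$; (b) if $U,V\in\mathcal{B}$ and $U\subseteq V$, then $U_q\subseteq V_q$ for every $q\in\mathbb{I}$; (c) if $U\in\mathcal{B}$ and $p<q$ are in $\mathbb{I}$, then $\operatorname{cl}(U_q)\subseteq U_p$. *)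

(* Defs.v *)
From HB Require Import structures.
From mathcomp Require Import all_boot all_order all_algebra.
From mathcomp Require Import all_classical all_reals all_analysis.
Import Order.TTheory GRing.Theory Num.Theory.
Import numFieldNormedType.Exports.

Set Implicit Arguments.
Unset Strict Implicit.
Unset Printing Implicit Defensive.

Local Open Scope classical_set_scope.
Local Open Scope ring_scope.

Definition II : set rat := [set q | 0 < q < 1].

(* A family {f_U : U \in B} is a function on all of [set X], constrained only
   at members of B.  Each f_U takes its values in R, with range contained in
   [0, 1]; continuity into the subspace [0, 1] is then continuity into R. *)
Definition B_stratification (R : realType) (X : topologicalType)
    (B : set (set X)) (f : set X -> X -> R) : Prop :=
  [/\ forall U, B U -> forall x, 0 <= f U x <= 1,
      forall U, B U -> U = f U @^-1` `]0, 1],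
      forall U V, B U -> B V -> U `<=` V -> forall x, f U x <= f V x &
      forall U, B U -> continuous (f U)].

(* [A U q] is U_q, constrained only for U \in B and q \in II. *)
Definition B_approximation (X : topologicalType)
    (B : set (set X)) (A : set X -> rat -> set X) : Prop :=
  [/\ forall U q, B U -> II q -> open (A U q),
      forall U, B U -> U = \bigcup_(q in II) A U q,
      forall U V, B U -> B V -> U `<=` V ->
        forall q, II q -> A U q `<=` A V q &
      forall U p q, B U -> II p -> II q -> p < q ->
        closure (A U q) `<=` A U p].

Definition approx_fun (R : realType) (X : topologicalType)
    (A : set X -> rat -> set X) (U : set X) (x : X) : R :=
  if x \in U then sup [set ratr q | q in [set q | II q /\ A U q x]] else 0.

(* Main.v *)
Require Import Defs.
From mathcomp Require Import all_boot all_order all_algebra.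
From mathcomp Require Import all_classical all_reals all_analysis.
Import Order.TTheory GRing.Theory Num.Theory.
Import numFieldNormedType.Exports.

Local Open Scope classical_set_scope.

(* For c >= 0, {f_U > c} is the union of the U_q with q > c, hence open.  If
   f_U x < p < q < c, then x lies outside U_p, hence outside cl(U_q), and
   f_U <= q holds on the open complement of cl(U_q). *)

Section ApproxFun.
Local Open Scope ring_scope.
Variables (R : realType) (X : topologicalType) (B : set (set X)).
Variables (A : set X -> rat -> set X) (hA : B_approximation B A).
Implicit Types (U V : set X) (x : X) (q : rat) (c : R).

Local Notation f := (@approx_fun R X A).

Lemma ratr_II q : II q -> 0 < (ratr q : R) <= 1.
Proof. by move=> /andP[q0 q1]; rewrite ltr0q q0 -(rmorph1 (@ratr R)) ler_rat ltW. Qed.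

Lemma approx_fun_ge U x q : B U -> II q -> A U q x -> ratr q <= f U x.
Proof.
move=> BU Iq Aq; have [_ hU _ _] := hA.
have Ux : U x by rewrite (hU _ BU); exists q.
rewrite /approx_fun mem_set//; apply: ub_le_sup; last by exists q.
(* Every index is below [1], so the set is bounded above; [sup] of an unbounded set would be a
   default value. *)
by exists 1 => _ [r [Ir _] <-]; case/andP: (ratr_II _ Ir).
Qed.

(** On [U] the union condition makes the index set nonempty, so its supremum is at most any upper
    bound. Off [U] the value is [0], whence the condition [0 <= c]. *)
Lemma approx_fun_le U x c : B U -> 0 <= c ->
  (forall q, II q -> A U q x -> ratr q <= c) -> f U x <= c.
Proof.
move=> BU c0 hc; have [_ hU _ _] := hA.
rewrite /approx_fun; case: ifPn => // /set_mem; rewrite {1}(hU _ BU).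
move=> [q Iq Aq]; apply: ge_sup; first by exists (ratr q); exists q.
by move=> _ [r [Ir Ar] <-]; exact: hc.
Qed.

Lemma approx_fun_gt0 U x : B U -> U x <-> 0 < f U x.
Proof.
move=> BU; have [_ hU _ _] := hA; split; last first.
  by rewrite /approx_fun; case: ifPn => [/set_mem//|_]; rewrite ltxx.
rewrite {1}(hU _ BU) => -[q Iq Aq]; have /andP[q0 _] := ratr_II _ Iq.
exact: lt_le_trans q0 (approx_fun_ge _ _ _ BU Iq Aq).
Qed.

Lemma approx_fun_itv U x : B U -> 0 <= f U x <= 1.
Proof.
move=> BU; apply/andP; split; last first.
  by apply: approx_fun_le => // q /ratr_II /andP[].
have [/(approx_fun_gt0 _ _ BU)/ltW//|nUx] := pselect (U x).
by rewrite /approx_fun memNset.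
Qed.

(** Each index available at [x] for [U] is also available for [V], so [f V x] is an upper bound. *)
Lemma approx_fun_mono U V x : B U -> B V -> U `<=` V -> f U x <= f V x.
Proof.
move=> BU BV UV; have [_ _ hm _] := hA.
apply: approx_fun_le => //; first by case/andP: (approx_fun_itv _ x BV).
by move=> q Iq Aq; apply: approx_fun_ge => //; exact: hm UV _ Iq _ Aq.
Qed.

Lemma near_approx_fun_gt U x c : B U -> c < f U x ->
  \forall t \near x, c < f U t.
Proof.
(* A negative [c] lies below [f U] everywhere, even off [U], where no [U_q] contains the point. *)
move=> BU cx; have [oA _ _ _] := hA; have [c0|c0] := ltP c 0.
  apply: nearW => t; apply: lt_le_trans c0 _.
  by case/andP: (approx_fun_itv _ t BU).
(* Otherwise the nonnegative [c] would bound all indices available at [x], hence [f U x] itself. *)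
have [q [Iq Aq cq]] : exists q, [/\ II q, A U q x & c < ratr q].
  apply: contrapT => hn; move: cx; rewrite ltNge => /negP; apply.
  apply: approx_fun_le => // q Iq Aq; rewrite leNgt; apply/negP => cq.
  by apply: hn; exists q.
near=> t; apply: lt_le_trans cq _; apply: approx_fun_ge => //.
by near: t; apply: open_nbhs_nbhs; split=> //; exact: oA.
Unshelve. all: by end_near. Qed.

Lemma near_approx_fun_lt U x c : B U -> f U x < c ->
  \forall t \near x, f U t < c.
Proof.
(* Above [1] the bound holds everywhere. For [c <= 1], rationals strictly between [f U x >= 0] and
   [c] fall in [II]. *)
move=> BU xc; have [_ _ _ cA] := hA; have [c1|c1] := ltP 1 c.
  apply: nearW => t; apply: le_lt_trans c1.
  by case/andP: (approx_fun_itv _ t BU).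
have /andP[fx0 _] := approx_fun_itv _ x BU.
have [q /itvP qxc] := rat_in_itvoo xc.
have xq : f U x < ratr q by rewrite qxc.
have qc : ratr q < c by rewrite qxc.
have [p /itvP pxq] := rat_in_itvoo xq.
have xp : f U x < ratr p by rewrite pxq.
have pq : p < q by rewrite -(ltr_rat R) pxq.
have p0 : 0 < p by rewrite -(ltr0q R); exact: le_lt_trans xp.
have q1 : q < 1 by rewrite -(ltr_rat R) rmorph1; exact: lt_le_trans c1.
have Ip : II p by apply/andP; split=> //; exact: lt_trans q1.
have Iq : II q by apply/andP; split=> //; exact: lt_trans pq.
have nx : (~` closure (A U q)) x.
  move=> /(cA _ _ _ BU Ip Iq pq) Ap.
  by have := approx_fun_ge _ _ _ BU Ip Ap; rewrite leNgt xp.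
have : \forall t \near x, (~` closure (A U q)) t.
  by apply: open_nbhs_nbhs; split=> //; apply: closed_openC; exact: closed_closure.
apply: filterS => t nt; apply: le_lt_trans qc; apply: approx_fun_le => //.
  by rewrite ler0q; case/andP: Iq => /ltW.
(* An index [r > q] available at [t] would put [t] in cl(U_r), hence in U_q, against the choice of
   [t] outside cl(U_q). *)
move=> r Ir Ar; rewrite ler_rat leNgt; apply/negP => qr; apply: nt.
apply: subset_closure; apply: (cA _ _ _ BU Iq Ir qr).
exact: subset_closure.
Qed.

(** Lower and upper semicontinuity, applied at [f U x - e] and [f U x + e], together give
    continuity. *)
Lemma approx_fun_continuous U : B U -> continuous (f U).
Proof.
move=> BU x; apply/cvgrPdist_lt => e e0; near=> t.
rewrite distrC ltr_distl; apply/andP; split; near: t.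
  by apply: near_approx_fun_gt => //; rewrite ltrBlDr ltrDl.
by apply: near_approx_fun_lt => //; rewrite ltrDl.
Unshelve. all: by end_near. Qed.

End ApproxFun.

Theorem proposition3 (R : realType) (X : topologicalType)
    (hX : kolmogorov_space X) (B : set (set X)) (hB : B `<=` open)
    (A : set X -> rat -> set X) (hA : B_approximation B A) :
  B_stratification B (@approx_fun R X A).
Proof.
split.
- by move=> U BU x; exact: approx_fun_itv hA _ _ BU.
- move=> U BU; apply/seteqP; split=> x /=; rewrite in_itv /=.
  + move=> /(approx_fun_gt0 R _ _ _ hA _ _ BU) ->.
    by case/andP: (approx_fun_itv R _ _ _ hA _ x BU).
  + by move=> /andP[f0 _]; apply/(approx_fun_gt0 R _ _ _ hA _ _ BU).
- by move=> U V BU BV UV x; exact: approx_fun_mono hA _ _ _ BU BV UV.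
- by move=> U BU; exact: approx_fun_continuous hA _ BU.
Qed.
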